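(* Assume that $X[\mathcal{T}]$ is a locally convex topological vector space; $|||\cdot|||$ is a seminorm on $X$ that is $\mathcal{T}$-lower-semicontinuous; $C_k=X\cap\{x:|||x|||\le k\}$ for each $k\in\mathbb{N}$; $C_k[\mathcal{T}|_{C_k}]$ is first countable for each $k\in\mathbb{N}$; and $\mathcal{C}=\{C_k:k\in\mathbb{N}\}$. Consider the propositions: (1) $X[\mathcal{T}]$ is barrelled. (2) $X[\mathcal{T}_{\mathcal{C}}]$ is barrelled. (3) $|||\cdot|||$ is $\mathcal{T}$-continuous. (4) $|||\cdot|||$ is sequentially $\mathcal{T}$-continuous. (5) $|||\cdot|||$ is sequentially $\mathcal{T}_{\mathcal{C}}$-continuous. (6) $|||\cdot|||$ is $\mathcal{T}_{\mathcal{C}}$-continuous. (7) $X[\mathcal{T}_{\mathcal{C}}]$ is Fréchet–Urysohn. (8) $X[\mathcal{T}_{\mathcal{C}}]$ is bornological. (9) $\mathcal{T}_{\mathrm{seq}}=\mathcal{T}_{\mathcal{C}}$. (10) $\mathcal{T}=\mathcal{T}_{\mathcal{C}}$. The following hold. (A) $(4)\iff(5)\iff(6)\iff(7)\iff(8)$. (B) $[(1)\vee(2)\vee(3)]\Rightarrow[(4)\wedge(5)\wedge(6)\wedge(7)\wedge(8)]$. (C) $(3)\Rightarrow(10)$. (D) If $\mathcal{T}_{\mathcal{C}}$ is sequential then $[(4)\vee(5)\vee(6)\vee(7)\vee(8)]\Rightarrow(9)$. (E) If both $\mathcal{T}$ and $\mathcal{T}_{\mathcal{C}}$ are sequential then: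 (a) $(3)\iff(4)\iff(5)\iff(6)\iff(7)\iff(8)$; (b) $(1)\iff(2)$; (c) $[(1)\vee(2)]\Rightarrow[(3)\wedge(4)\wedge(5)\wedge(6)\wedge(7)\wedge(8)]$; (d) $[(3)\vee(4)\vee(5)\vee(6)\vee(7)\vee(8)]\Rightarrow(10)$.
   Context: All vector spaces are real; topological vector spaces are Hausdorff. $X[\mathcal{T}]$ denotes $X$ equipped with the topology $\mathcal{T}$; $\mathcal{T}|_C=\{E\cap C:E\in\mathcal{T}\}$. A localizing family in a vector space $X$ is a non-empty collection $\mathcal{C}$ of convex subsets of $X$ containing $0$ such that for all $C\in\mathcal{C}$, $x\in X$, $t\in\mathbb{R}$ there is $D\in\mathcal{C}$ with $x+t\cdot C\subseteq D$ (the family $\mathcal{C}$ of the claim is one). Given a locally convex topology $\mathcal{T}$ on $X$ and a localizing family $\mathcal{C}$, the localization $\mathcal{T}_{\mathcal{C}}$ is the locally convex vector topology on $X$ consisting of all $E\subseteq X$ such that for every $x\in E$ there is a convex $V$ with $x\in V\subseteq E$ and $V\cap C\in\mathcal{T}|_C$ for every $C\in\mathcal{C}$. A subset $A$ of a Hausdorff space is sequentially open if every sequence converging to a point of $A$ is eventually in $A$. $\mathcal{T}_{\mathrm{seq}}$ is the topology consisting of all sequentially $\mathcal{T}$-open sets. A topology is sequential if every sequentially open set is open (i.e. $\mathcal{T}=\mathcal{T}_{\mathrm{seq}}$). A Hausdorff space is Fréchet–Urysohn if for every subset $A$ and every $x$ in the closure of $A$ there is a sequence in $A$ converging to $x$.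 A locally convex space is barrelled if each absolutely convex, closed, absorbing set is a neighbourhood of $0$; it is bornological if each convex balanced set absorbing every bounded set is a neighbourhood of $0$. *)

(* Defs.v *)
From HB Require Import structures.
From mathcomp Require Import all_boot all_order all_algebra.
From mathcomp Require Import all_classical.
From mathcomp Require Import interval_inference reals ereal topology normedtype convex.

Set Implicit Arguments.
Unset Strict Implicit.
Unset Printing Implicit Defensive.

Import Order.TTheory GRing.Theory Num.Theory.
Import numFieldNormedType.Exports.

Local Open Scope classical_set_scope.
Local Open Scope ring_scope.

Section sequences_in_spaces.
Context {T : topologicalType}.

Definition sequentially_open (A : set T) :=
  forall (u : nat -> T) (x : T),
    A x -> u @ \oo --> x -> \forall n \near \oo, A (u n).

Definition sequentially_continuous {U : topologicalType} (f : T -> U) :=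
  forall (u : nat -> T) (x : T),
    u @ \oo --> x -> f (u n) @[n --> \oo] --> f x.

End sequences_in_spaces.

Definition seq_topology (T : topologicalType) : set_system T :=
  [set A | sequentially_open A].
Arguments seq_topology T : clear implicits.

Definition sequential (T : topologicalType) :=
  forall A : set T, sequentially_open A -> open A.

Definition frechet_urysohn (T : topologicalType) :=
  forall (A : set T) (x : T), closure A x ->
    exists u : nat -> T, (forall n, A (u n)) /\ u @ \oo --> x.

Definition first_countable (T : topologicalType) :=
  forall x : T, exists2 B : set_system T,
    countable B & nbhs x = filter_from B id.

Section absorption.
Context {R : realType} {X : lmodType R}.

Definition balanced (A : set X) :=
  forall (a : R) (x : X), `|a| <= 1 -> A x -> A (a *: x).

Definition absorbs (A B : set X) :=
  exists2 r : R, 0 < r &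
    forall a : R, r <= `|a| -> B `<=` [set a *: x | x in A].

Definition absorbing (A : set X) := forall x, absorbs A [set x].

(* nonnegativity and p 0 = 0 follow from these two conditions *)
Definition seminorm (p : X -> R) :=
  (forall x y, p (x + y) <= p x + p y) /\
  (forall (a : R) x, p (a *: x) = `|a| * p x).

Definition localizing_family (CC : set (set X)) :=
  [/\ CC !=set0,
      (forall C, CC C -> convex_set C /\ C 0) &
      (forall C x (a : R), CC C ->
         exists2 D, CC D & [set x + a *: y | y in C] `<=` D)].

Definition sublevel_family (p : X -> R) : set (set X) :=
  range (fun k : nat => [set x | p x <= k%:R]).

End absorption.

Section barrelled_bornological.
Context {R : realType}.

(* boundedness in the sense of topological vector spaces; the library's
   [bounded_set] is about norms *)
Definition tvs_bounded {X : preTopologicalLmodType R} (B : set X) :=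
  forall U : set X, nbhs 0 U -> absorbs U B.

Definition barrelled (X : preTopologicalLmodType R) :=
  forall A : set X, convex_set A -> balanced A -> closed A -> absorbing A ->
    nbhs 0 A.

Definition bornological (X : preTopologicalLmodType R) :=
  forall A : set X, convex_set A -> balanced A ->
    (forall B, tvs_bounded B -> absorbs A B) -> nbhs 0 A.

End barrelled_bornological.

(* a copy of the vector space X, equipped below with the localized topology;
   it depends on the family so that the topology can be inferred from it *)
Definition localization {R : realType} {X : preTopologicalLmodType R}
  (CC : set (set X)) : Type := X.
Arguments localization {R X} CC : simpl never.

Section localization.
Context {R : realType} {X : preTopologicalLmodType R} (CC : set (set X)).

Definition localized_open (E : set X) :=
  forall x, E x -> exists V : set X,
    [/\ convex_set V, V x, V `<=` E &
        forall C, CC C -> [set W `&` C | W in open] (V `&` C)].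

HB.instance Definition _ := GRing.Lmodule.copy (localization CC) X.

Let localized_openT : localized_open setT.
Proof.
move=> x _; exists setT; split => // C _; exists setT => //; exact: openT.
Qed.

Let localized_openI : setI_closed localized_open.
Proof.
move=> E F oE oF x [Ex Fx].
have [V [cV Vx VE oV]] := oE x Ex; have [W [cW Wx WF oW]] := oF x Fx.
exists (V `&` W); split => //.
- move=> y z l /set_mem[Vy Wy] /set_mem[Vz Wz]; apply/mem_set; split.
  + by apply/set_mem/cV; exact/mem_set.
  + by apply/set_mem/cW; exact/mem_set.
- exact: setISS.
- move=> C CC_C; have [V' oV' V'C] := oV C CC_C; have [W' oW' W'C] := oW C CC_C.
  exists (V' `&` W'); first exact: openI.
  by rewrite setIIl V'C W'C -setIIl.
Qed.

Let localized_open_bigU (I : Type) (f : I -> set X) :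
  (forall i, localized_open (f i)) -> localized_open (\bigcup_i f i).
Proof.
move=> of_ x [i _ fix_]; have [V [cV Vx Vf oV]] := of_ i x fix_.
by exists V; split => // y Vy; exists i => //; exact: Vf.
Qed.

HB.instance Definition _ := isOpenTopological.Build (localization CC)
  localized_openT localized_openI localized_open_bigU.

Lemma localization_openE :
  @open (localization CC) = (localized_open : set_system X).
Proof. by []. Qed.

End localization.

Lemma sublevel_family_localizing {R : realType} {X : lmodType R} (p : X -> R) :
  seminorm p -> localizing_family (sublevel_family p).
Proof.
move=> [pD pZ]; have p0 : p 0 = 0 by rewrite -(scale0r 0) pZ normr0 mul0r.
split; first by exists [set x | p x <= 0%:R]; exists 0%N.
- move=> _ [k _ <-]; split => /=; last by rewrite p0.
  move=> y z l /set_mem/= py /set_mem/= pz; apply/mem_set => /=.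
  have l1 : 0 <= 1 - l%:num by rewrite subr_ge0.
  rewrite (le_trans (pD _ _))// !pZ !ger0_norm//.
  rewrite [leRHS](_ : _ = l%:num * k%:R + (1 - l%:num) * k%:R); last first.
    by rewrite -mulrDl subrKC mul1r.
  by rewrite lerD// ler_wpM2l.
- move=> _ x a [k _ <-].
  have [n _ hn] : exists2 n : nat, true & p x + `|a| * k%:R <= n%:R.
    exists (Num.truncn `|p x + `|a| * k%:R|).+1 => //.
    by rewrite (le_trans (ler_norm _))// ltW// truncnS_gt.
  exists [set x | p x <= n%:R]; first by exists n.
  move=> _ [y /= py <-]; apply: le_trans hn.
  by rewrite (le_trans (pD _ _))// lerD2l pZ ler_wpM2l.
Qed.

(* Main.v *)
(* Write C_k = {p <= k}, T for the topology of X and T_C for the localized one;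
   T_C refines T and both induce the same topology on each C_k. Every one of
   the conditions (1)-(8) implies that p is T-continuous, and this in turn
   implies T = T_C and the conditions (3)-(8); sequentiality of the topologies
   plays no role in this.
   A convex T-neighbourhood W of 0 whose trace on C_1 lies in {p < 1} lies in
   C_1, because x in W with p x > 1 would give x / p x in W, of seminorm one.
   Hence T_C-continuity of p at 0, which only concerns the trace on C_1, yields
   T-continuity, and by first countability of C_1 sequential continuity is
   enough. If p y_n > n for all n, some T_C-neighbourhood of 0 avoids all the
   y_n; so p is bounded on T_C-bounded sets and along T_C-null sequences, which
   handles the bornological and the Frechet-Urysohn conditions. Conversely, if
   p is T-continuous then the C_k are neighbourhoods, so that T = T_C is first
   countable. *)
Require Import Defs.
From mathcomp Require Import all_boot all_order all_algebra.
From mathcomp Require Import all_classical.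
From mathcomp Require Import interval_inference reals ereal topology.
From mathcomp Require Import normedtype convex.
Import Order.TTheory GRing.Theory Num.Theory.
Import numFieldNormedType.Exports.
Set Implicit Arguments.
Unset Strict Implicit.
Unset Printing Implicit Defensive.
Local Open Scope classical_set_scope.
Local Open Scope ring_scope.

(** * Convexity with real coefficients *)

Lemma convexP {R : realType} {X : lmodType R} (A : set X) :
  convex_set A <-> forall (x y : X) (t : R), 0 <= t -> t <= 1 ->
    A x -> A y -> A (t *: x + (1 - t) *: y).
Proof.
split=> [cA x y t t0 t1 Ax Ay|cA x y l /set_mem Ax /set_mem Ay].
  by apply/set_mem; exact: (cA _ _ (Itv01 t0 t1) (mem_set Ax) (mem_set Ay)).
by apply/mem_set/cA.
Qed.

Lemma convex_preimage_affine {R : realType} {X : lmodType R} (A : set X) x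
    (a : R) :
  convex_set A -> convex_set [set y | A (x + a *: y)].
Proof.
move=> /convexP cA; apply/convexP => y z t t0 t1 /= Ay Az.
have := cA _ _ _ t0 t1 Ay Az.
rewrite !scalerDr [_ + _ *: _ + _]addrACA -scalerDl subrKC scale1r.
by rewrite !scalerA ![a * _]mulrC.
Qed.

(** * Countable neighbourhood bases and sequences *)

Section topology_facts.

Lemma subtype_nbhs {T : topologicalType} (A : set T) (x : set_type A)
    (B : set (set_type A)) :
  nbhs x B <-> exists2 W, nbhs (\val x) W & (fun y => W (\val y)) `<=` B.
Proof.
split.
  case=> _ [[W oW <-] Wx WB]; exists W; last first.
    by move=> y Wy; apply: WB; rewrite /preimage/= set_valE.
  by apply: open_nbhs_nbhs; split => //; move: Wx; rewrite /preimage/= set_valE.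
move=> [W]; rewrite nbhsE => -[V [oV Vx] VW] WB.
exists (set_val @^-1` V); split; first by exists V.
  by rewrite /preimage/= set_valE.
by move=> y; rewrite /preimage/= set_valE => /VW /WB.
Qed.

(** Each member of a countable base at [x] in the subspace contains the trace of a neighbourhood in
    [T]; finite intersections of these make the sequence decreasing. *)
Lemma first_countable_nbhs_seq {T : topologicalType} (A : set T) (x : T) :
  first_countable (set_type A) -> A x ->
  exists U : nat -> set T, [/\ forall n, nbhs x (U n),
    forall m n, (m <= n)%N -> U n `<=` U m &
    forall W, nbhs x W -> exists n, U n `&` A `<=` W].
Proof.
move=> fcA Ax; pose x' : set_type A := exist _ x (mem_set Ax).
have [B cB nE] := fcA x'.
have [B0 BB0] : B !=set0.
  have : nbhs x' setT by exact: filterT.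
  by rewrite nE => -[b Bb _]; exists b.
have /countable_injP[f f_inj] := cB.
(* [g] enumerates [B]; the default [B0] fills the indices that [f] attains at no member of [B]. *)
pose g n := xget B0 [set b | B b /\ f b = n].
have Bg n : B (g n) by rewrite /g; case: xgetP => // y _ [].
have gf b : B b -> g (f b) = b.
  move=> Bb; rewrite /g; case: xgetP => [y _ [By fy]|/(_ b)/not_andP[]//].
  by apply: f_inj => //; apply/mem_set.
have /choice[w wP] n : exists W, nbhs x W /\ ((fun y => W (\val y)) `<=` g n).
  have : nbhs x' (g n) by rewrite nE; exists (g n).
  by move=> /subtype_nbhs[W Wx Wg]; exists W.
exists (fun n => [set y | forall i : 'I_n.+1, w i y]); split.
- by move=> n; apply: filter_forall => i; have [] := wP i.
- move=> m n mn y /= H i; apply: (H (widen_ord _ i)).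
  by rewrite ltnS.
- move=> W Wx; have : nbhs x' ((fun y => W (\val y)) : set (set_type A)).
    by apply/subtype_nbhs; exists W.
  rewrite nE => -[b Bb bW]; exists (f b) => y [/(_ ord_max)/= wy Ay].
  have := (wP (f b)).2 (exist _ y (mem_set Ay)) wy.
  by rewrite gf// => /bW.
Qed.

Lemma frechet_urysohn_nbhs_seq {T : topologicalType} :
  (forall x : T, exists U : nat -> set T, [/\ forall n, nbhs x (U n),
    forall m n, (m <= n)%N -> U n `<=` U m &
    forall W, nbhs x W -> exists n, U n `<=` W]) ->
  frechet_urysohn T.
Proof.
move=> H A x clA; have [U [nU dU bU]] := H x.
have /choice[u uP] n : exists y, (A `&` U n) y by exact: clA.
exists u; split=> [n|W /bU[n UW]]; first by have [] := uP n.
by exists n => // m /= nm; apply: UW; apply: dU nm _ _; have [] := uP m.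
Qed.

Lemma continuous_sequentially {T U : topologicalType} (f : T -> U) :
  continuous f -> sequentially_continuous f.
Proof. by move=> cf u x ux; apply: continuous_cvg => //; exact: cf. Qed.

End topology_facts.

(** * Affine maps and convex neighbourhoods *)

Section tvs_facts.
Context {R : realType} {X : tvsType R}.

Lemma affine_continuous (x : X) (a : R) : continuous (fun y : X => x + a *: y).
Proof.
move=> y; apply: (@continuous2_cvg _ _ _ _ _ _ _ _ (fun u v : X => u + v)).
- exact: (@add_continuous X (x, a *: y)).
- exact: cvg_cst.
- apply: (@continuous2_cvg _ R^o _ _ _ _ _ _ (fun (u : R) (v : X) => u *: v)).
  + exact: (@scale_continuous R X (a, y)).
  + exact: cvg_cst.
  + exact: cvg_id.
Qed.

Lemma convex_nbhs (x : X) (W : set X) : nbhs x W ->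
  exists V, [/\ open V, convex_set V, V x & V `<=` W].
Proof.
move=> xW; have [B cB [oB bB]] := @locally_convex R X.
have [V [BV Vx] VW] := bB x _ xW.
by exists V; split => //; [exact: oB|exact/cB/mem_set].
Qed.

End tvs_facts.

(** * The localized topology of a general family *)

Section localization_facts.
Context {R : realType} {X : tvsType R} (CC : set (set X)).
Local Notation XC := (localization CC).

Lemma open_localized (E : set X) : open E -> @open XC E.
Proof.
rewrite localization_openE => oE x Ex.
have [|V [oV cV Vx VE]] := @convex_nbhs _ _ x E.
  by apply: open_nbhs_nbhs; split.
by exists V; split => // C _; exists V.
Qed.

Lemma nbhs_localized (x : X) (E : set X) : nbhs x E -> nbhs (x : XC) E.
Proof.
rewrite nbhsE => -[V [oV Vx] VE]; rewrite nbhsE; exists V => //.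
by split=> //; exact: open_localized.
Qed.

Lemma localized_nbhs_trace (x : X) (N C : set X) : nbhs (x : XC) N ->
  CC C -> C x -> exists2 W, nbhs x W & W `&` C `<=` N.
Proof.
rewrite nbhsE => -[E [+ Ex] EN] CCC Cx.
rewrite localization_openE => oE.
have [V [_ Vx VE /(_ _ CCC)[W oW WV]]] := oE x Ex.
have [Wx _] : (W `&` C) x by rewrite WV.
exists W; first by apply: open_nbhs_nbhs.
by rewrite WV => y [/VE/EN].
Qed.

Lemma localized_open_convex (V : set X) : convex_set V ->
  (forall C, CC C -> [set W `&` C | W in open] (V `&` C)) -> @open XC V.
Proof. by rewrite localization_openE => cV oV x Vx; exists V; split. Qed.

(** The map sends each member [C] into some member [D], so the trace on [C] of a preimage is
    determined by the trace of [V] on [D]. *)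
Lemma localized_affine_continuous (x : XC) (a : R) : localizing_family CC ->
  continuous (fun y : XC => x + a *: y).
Proof.
move=> [_ _ CCD]; apply/continuousP => E; rewrite localization_openE => oE y Ey.
have [V [cV Vy VE oV]] := oE _ Ey.
exists [set y | V (x + a *: y)]; split => //.
- exact: convex_preimage_affine.
- by move=> z /VE.
- move=> C CCC; have [D CCD' CD] := CCD _ (x : X) a CCC.
  have [W oW WV] := oV _ CCD'.
  exists [set y | W ((x : X) + a *: y)].
    by have /continuousP := @affine_continuous R X x a; apply.
  apply/seteqP; split => z [Wz Cz]; split => //.
    have : (W `&` D) (x + a *: z) by split => //; apply: CD; exists z.
    by rewrite WV => -[].
  have : (V `&` D) (x + a *: z) by split => //; apply: CD; exists z.
  by rewrite -WV => -[].
Qed.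

End localization_facts.

(** * Bounded sets and bornological spaces *)

Section tvs_bounded_facts.
Context {R : realType} {X : tvsType R}.

Lemma scale_near0 (x : X) (W : set X) : nbhs (0 : X) W ->
  \forall a \near (0 : R), W (a *: x).
Proof.
move=> nW; suff: (fun a : R^o => a *: x) a @[a --> (0 : R^o)] --> (0 : X).
  by move=> /(_ _ nW).
rewrite -[X in _ --> X](scale0r x).
apply: (@continuous2_cvg _ R^o _ _ _ _ _ _ (fun (u : R^o) (v : X) => u *: v)).
- exact: (@scale_continuous R X (0, x)).
- exact: cvg_id.
- exact: cvg_cst.
Qed.

(** Joint continuity of scaling at [(0, 0)] handles a tail uniformly; the finitely many remaining
    terms are scaled into [W] one by one. *)
Lemma null_seq_bounded (u : nat -> X) : u @ \oo --> (0 : X) ->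
  tvs_bounded (range u).
Proof.
move=> u0 W nW.
have /nbhs_ballP[e /= e0 We] : \forall a \near (0 : R), forall n, W (a *: u n).
  have := @scale_continuous R X (0, 0) W; rewrite /= scale0r => /(_ nW).
  move=> [[A B] /= [nA nB] AB].
  have [N _ NB] := u0 _ nB.
  have nI : \forall a \near (0 : R), forall n : 'I_N, W (a *: u n).
    apply: (filter_forall (nbhs_filter (0 : R))) => n.
    exact: scale_near0.
  near=> a => n; have [nN|Nn] := ltnP n N.
    suff : forall n : 'I_N, W (a *: u n) by move=> /(_ (Ordinal nN)).
    by near: a.
  apply: (AB (a, u n)); split => /=; last exact: NB.
  by near: a.
exists (2 / e) => [|a ea]; first by rewrite divr_gt0.
have a0 : 0 < `|a| by rewrite (lt_le_trans _ ea)// divr_gt0.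
move=> _ [n _ <-]; exists (a^-1 *: u n).
  apply: We; rewrite /ball/= sub0r normrN normfV.
  rewrite invf_plt// (lt_le_trans _ ea)//.
  by rewrite -[ltLHS]mul1r ltr_pM2r ?invr_gt0// ltr1n.
by rewrite scalerA mulfV ?scale1r// -normr_gt0.
Unshelve. all: by end_near. Qed.

(** If [A] is not a neighbourhood, there are [x n] outside [A] with [(n+1) x n] in [U n]. These
    multiples form a null sequence, hence a bounded set, and absorbing it puts some [x n] into
    [A]. *)
Lemma bornological_nbhs_seq (U : nat -> set X) :
  (forall n, nbhs (0 : X) (U n)) ->
  (forall m n, (m <= n)%N -> U n `<=` U m) ->
  (forall W, nbhs (0 : X) W -> exists n, U n `<=` W) ->
  bornological X.
Proof.
move=> nU dU bU A _ _ absA; apply: contrapT => nA.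
have /choice[x xP] n : exists x, U n (n.+1%:R *: x) /\ ~ A x.
  apply: contrapT => /forallNP H; apply: nA.
  have := @affine_continuous R X 0 n.+1%:R 0 (U n).
  rewrite scaler0 addr0 => /(_ (nU n)).
  apply: (@filterS _ (nbhs (0 : X))) => x /=; rewrite add0r => Ux.
  by apply: contrapT => Ax; exact: (H x).
have y0 : (fun n => n.+1%:R *: x n) @ \oo --> (0 : X).
  move=> W /bU[n UW]; exists n => // m /= nm; apply: UW.
  by apply: dU nm _ _; have [] := xP m.
have [r r0 rA] := absA _ (null_seq_bounded y0).
pose n := Num.truncn r.
have [|z Az zx] := rA n.+1%:R _ (n.+1%:R *: x n) (ex_intro2 _ _ n I erefl).
  by rewrite normr_nat ltW// truncnS_gt.
apply: (xP n).2; rewrite (_ : x n = z)//.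
apply: (@scalerI _ _ n.+1%:R); last exact: esym.
by rewrite pnatr_eq0.
Qed.

End tvs_bounded_facts.

(** * Seminorms and their unit balls *)

Section seminorm_facts.
Context {R : realType}.

Lemma seminorm0 {X : lmodType R} (p : X -> R) : seminorm p -> p 0 = 0.
Proof. by move=> [_ pZ]; rewrite -(scale0r 0) pZ normr0 mul0r. Qed.

Lemma seminormN {X : lmodType R} (p : X -> R) x : seminorm p -> p (- x) = p x.
Proof. by move=> [_ pZ]; rewrite -scaleN1r pZ normrN1 mul1r. Qed.

Lemma seminorm_ge0 {X : lmodType R} (p : X -> R) x : seminorm p -> 0 <= p x.
Proof.
move=> sp; have := sp.1 x (- x).
by rewrite subrr seminorm0// seminormN// -mulr2n pmulrn_lge0.
Qed.

Lemma seminorm_unit_ball {X : lmodType R} (p : X -> R) : seminorm p ->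
  convex_set [set x | p x <= 1] /\ balanced [set x | p x <= 1].
Proof.
move=> sp; split.
  have [_ + _] := sublevel_family_localizing sp.
  by move=> /(_ _ (ex_intro2 _ _ 1%N I erefl))[].
move=> a x a1 /= px; rewrite sp.2 (le_trans _ px)// ler_piMl//.
exact: seminorm_ge0.
Qed.

Lemma seminorm_unit_ball_absorbs {X : lmodType R} (p : X -> R) (B : set X)
    (M : R) :
  seminorm p -> (forall x, B x -> p x <= M) -> absorbs [set x | p x <= 1] B.
Proof.
(* The 1 keeps the radius positive whatever the sign of [M]. *)
move=> sp BM; exists (Num.max 1 M); first by rewrite lt_max ltr01.
move=> a; rewrite ge_max => /andP[a1 aM] x Bx.
have a0 : 0 < `|a| by exact: lt_le_trans a1.
exists (a^-1 *: x) => /=; last by rewrite scalerA mulfV ?scale1r// -normr_gt0.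
by rewrite sp.2 normfV mulrC ler_pdivrMr// mul1r (le_trans (BM _ Bx)).
Qed.

Lemma seminorm_continuous {X : preTopologicalLmodType R} (p : X -> R) :
  (forall (x : X) (a : R), continuous (fun y : X => x + a *: y)) ->
  seminorm p -> nbhs (0 : X) [set x | p x <= 1] -> continuous (p : X -> R).
Proof.
move=> aff sp B1 x; apply/cvgrPdist_lt => e e0.
have e20 : 0 < 2 / e by rewrite divr_gt0.
(* The map [y |-> (2 / e) (y - x)] pulls the unit ball back to [p (y - x) <= e / 2], strictly below
   [e]. *)
have /(_ [set x | p x <= 1]) := aff (- (2 / e) *: x) (2 / e) x.
rewrite scaleNr addNr => /(_ B1); apply: (@filterS _ (nbhs x)) => y /=.
rewrite addrC -scalerBr sp.2 gtr0_norm// => pyx.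
apply: (@le_lt_trans _ _ (p (y - x))); last first.
  have : p (y - x) <= e / 2.
    by rewrite -(ler_pM2l e20) mulrA divfK ?gt_eqF// divff.
  move=> /le_lt_trans; apply; rewrite ltr_pdivrMr// ltr_pMr//.
  by rewrite ltr1n.
rewrite ler_norml; apply/andP; split.
  rewrite lerBrDl lerBlDr -{1}(subrK x y) addrC; exact: sp.1.
by rewrite lerBlDr -[p (y - x)](seminormN _ sp) opprB -{1}(subrK y x) sp.1.
Qed.

Lemma seminorm_unit_ball_barrelled {X : preTopologicalLmodType R} (p : X -> R) :
  seminorm p -> closed [set x : X | p x <= 1] -> barrelled X ->
  nbhs (0 : X) [set x | p x <= 1].
Proof.
move=> sp clB barX; have [cB bB] := seminorm_unit_ball sp; apply: barX => // x.
by apply: (seminorm_unit_ball_absorbs (M := p x)) => // _ ->.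
Qed.

(* A convex [W] containing [0] and a point [x] of seminorm larger than one also
   contains the point [x / p x] of seminorm one. *)
Lemma unit_ball_nbhs_of_trace {X : tvsType R} (p : X -> R) (W : set X) :
  seminorm p -> nbhs (0 : X) W -> (forall x, W x -> p x <= 1 -> p x < 1) ->
  nbhs (0 : X) [set x | p x <= 1].
Proof.
move=> sp /convex_nbhs[V [oV /convexP cV V0 VW]] W1.
rewrite nbhsE; exists V => // x Vx /=; rewrite leNgt; apply/negP => px.
have px0 : 0 < p x by exact: lt_trans px.
have pV1 : p ((p x)^-1 *: x) = 1.
  by rewrite sp.2 normfV gtr0_norm// mulVf// gt_eqF.
suff /VW /W1 : V ((p x)^-1 *: x) by rewrite pV1 lexx ltxx => /(_ isT).
have := cV x 0 (p x)^-1; rewrite scaler0 addr0; apply => //.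
  by rewrite invr_ge0 ltW.
by rewrite invf_le1// ltW.
Qed.

End seminorm_facts.

(** * Localization by the sublevel sets of a seminorm *)

Section localization_seminorm.
Context {R : realType} {X : tvsType R} (p : X -> R).
Hypothesis p_seminorm : seminorm p.
Local Notation XC := (localization (sublevel_family p)).

Let sublevel k : sublevel_family p [set x | p x <= k%:R].
Proof. by exists k. Qed.

Lemma localized_unit_ball_nbhs :
  nbhs (0 : XC) [set x : XC | p x <= 1] -> nbhs (0 : X) [set x | p x <= 1].
Proof.
move=> nB.
(* Pulling back along doubling leaves seminorm at most 1/2 on the trace, which gives the strict
   inequality required by [unit_ball_nbhs_of_trace]. *)
have := @localized_affine_continuous _ _ _ (0 : XC) 2
  (sublevel_family_localizing p_seminorm).
move=> /(_ 0 [set x : XC | p x <= 1]); rewrite scaler0 add0r => /(_ nB).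
move=> /(@localized_nbhs_trace _ _ _ 0 _ _)/(_ (sublevel 1))[|W nW].
  by rewrite /= (seminorm0 p_seminorm).
move=> WB; apply: (unit_ball_nbhs_of_trace p_seminorm nW) => x Wx px.
have /= := WB x (conj Wx px); rewrite add0r p_seminorm.2 ger0_norm//.
rewrite -ler_pdivlMl// mulr1 => /le_lt_trans; apply.
by rewrite invf_lt1// ltr1n.
Qed.

(** Otherwise every [U n] contains a point of seminorm exactly one. These points all lie in one
    sublevel set, so they form a null sequence for the localized topology, along which [p] stays at
    one. *)
Lemma sequentially_localized_unit_ball_nbhs :
  first_countable (set_type [set x : X | p x <= 1]) ->
  sequentially_continuous (p : XC -> R) -> nbhs (0 : X) [set x | p x <= 1].
Proof.
move=> fc1 scp; apply: contrapT => nB.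
have p0 := seminorm0 p_seminorm.
have [|U [nU dU bU]] := @first_countable_nbhs_seq _ _ (0 : X) fc1.
  by rewrite /= p0.
have /choice[u uP] n : exists x, [/\ U n x, p x <= 1 & 1 <= p x].
  apply: contrapT => /forallNP Un; apply: nB.
  apply: (unit_ball_nbhs_of_trace p_seminorm (nU n)) => x Ux px.
  by rewrite ltNge; apply/negP => px1; apply: (Un x).
have u0 : (u : nat -> XC) @ \oo --> (0 : XC).
  move=> N nN; have [|W nW WN] := localized_nbhs_trace nN (sublevel 1).
    by rewrite /= p0.
  have [n UW] := bU _ nW; exists n => // m /= nm; apply: WN.
  have [Um pm _] := uP m; split=> //; apply: UW; split => //.
  exact: dU nm _ _.
have := scp _ _ u0; rewrite p0 => /cvgr_lt/(_ 1 ltr01)[n _ /(_ n (leqnn n))] /=.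
by rewrite ltNge; have [_ _ ->] := uP n.
Qed.

Lemma unit_ball_nbhs_continuous :
  nbhs (0 : X) [set x | p x <= 1] -> continuous (p : X -> R).
Proof. by apply: seminorm_continuous => //; exact: affine_continuous. Qed.

Lemma continuous_localizationE :
  continuous (p : X -> R) -> (@open X : set (set X)) = @open XC.
Proof.
move=> cp; apply/seteqP; split=> [E|E]; first exact: open_localized.
rewrite localization_openE => oE; rewrite openE => x Ex.
have [V [_ Vx VE oV]] := oE x Ex.
(* As [k] is strictly above [p x], the set [p y < k] is a neighbourhood of [x], and on it [V] and
   the open set [W] agree. *)
pose k := (Num.truncn (p x)).+1.
have [W oW WV] := oV _ (sublevel k).
have [Wx _] : (W `&` [set x | p x <= k%:R]) x.
  by rewrite WV; split => //=; rewrite ltW// truncnS_gt.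
have pk : nbhs x [set y | p y < k%:R].
  by apply: (cvgr_lt _ (cp x)); rewrite truncnS_gt.
have nW : nbhs x W by apply: open_nbhs_nbhs; split.
rewrite /interior; near=> y; apply: VE.
suff [] : (V `&` [set y | p y <= k%:R]) y by [].
rewrite -WV; split; first by near: y.
by apply: ltW; near: y.
Unshelve. all: by end_near. Qed.

Lemma continuous_localization_nbhs (x : X) (E : set X) :
  continuous (p : X -> R) -> nbhs x E = nbhs (x : XC) E.
Proof.
move=> /continuous_localizationE oE; apply/propext; split.
  exact: nbhs_localized.
rewrite nbhsE => -[V [oV Vx] VE]; rewrite nbhsE; exists V => //.
by split => //; move: oV; rewrite -oE.
Qed.

(** * Localized neighbourhoods avoiding points of large seminorm *)

Lemma open_sumset (A U : set X) : open U ->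
  open [set x : X | exists2 c, A c & U (x - c)].
Proof.
move=> oU; rewrite (_ : mkset _ = \bigcup_(c in A) [set x | U (- c + 1 *: x)]).
  apply: bigcup_open => c _.
  by have /continuousP := @affine_continuous R X (- c) 1; apply.
by apply/seteqP; split=> x [c Ac Uc]; exists c => //;
  move: Uc => /=; rewrite scale1r addrC.
Qed.

(* [V] is the intersection of the open convex sets [C_n + U_n], where [U_n] is
   so small that [y_n] is not in [C_n + U_n], using that [C_n] is closed. On
   [C_k] only the finitely many factors with [n < k] matter. *)
Lemma localized_nbhs_avoid (y : nat -> X) :
  lower_semicontinuous (fun x => (p x)%:E) -> (forall n, n%:R < p (y n)) ->
  exists2 V, nbhs (0 : XC) V & forall n, ~ V (y n).
Proof.
move=> /lower_semicontinuousP lsc yn.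
have /choice[U UP] n : exists U : set X, [/\ open U, convex_set U, U 0 &
    forall x, U x -> n%:R < p (y n - x)].
  have /convex_nbhs[U [oU cU U0 UW]] :
      nbhs (0 : X) [set x | n%:R < p (y n + -1 *: x)].
    have /continuousP aff := @affine_continuous R X (y n) (-1).
    apply: open_nbhs_nbhs; split; last by rewrite /= scaler0 addr0.
    by have := aff _ (lsc n%:R); congr open; apply/seteqP; split=> z /=;
      rewrite lte_fin.
  by exists U; split => // x /UW /=; rewrite scaleN1r.
pose V := [set x : X | forall n, exists2 c, p c <= n%:R & U n (x - c)].
have V0 : V 0.
  move=> n; exists 0; first by rewrite (seminorm0 p_seminorm).
  by rewrite subr0; have [] := UP n.
have cV : convex_set V.
  apply/convexP => a b t t0 t1 Va Vb n.
  have [c pc Uc] := Va n; have [d pd Ud] := Vb n.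
  have [_ /convexP cU _ _] := UP n.
  have [_ cC _] := sublevel_family_localizing p_seminorm.
  exists (t *: c + (1 - t) *: d).
    by have /convexP/(_ c d t) := (cC _ (sublevel n)).1; apply.
  have := cU _ _ _ t0 t1 Uc Ud.
  by rewrite !scalerBr addrACA -opprD.
exists V; last first.
  move=> n /(_ n)[c pc]; have [_ _ _ Un /Un] := UP n.
  by rewrite subKr ltNge pc.
apply: open_nbhs_nbhs; split=> //; apply: localized_open_convex => //.
move=> _ [k _ <-].
exists [set x : X | forall n : 'I_k, exists2 c, p c <= n%:R & U n (x - c)].
  rewrite openE => x /= Ux; apply: filter_forall => n.
  have [oU _ _ _] := UP n.
  have := @open_sumset [set c | p c <= n%:R] _ oU.
  by rewrite openE => /(_ x (Ux n)).
apply/seteqP; split => x /= [Vx px]; split => // n.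
have [nk|kn] := ltnP n k; first exact: (Vx (Ordinal nk)).
exists x; first by rewrite (le_trans px)// ler_nat.
by rewrite subrr; have [] := UP n.
Qed.

Hypothesis p_lsc : lower_semicontinuous (fun x => (p x)%:E).

(** Otherwise [B] has points [x n] with [p] above [(n+1)^2]. Divided by [n+1] they still have
    seminorm above [n], so some neighbourhood avoids all the quotients and cannot absorb [B]. *)
Lemma localized_bounded_seminorm (B : set X) :
  tvs_bounded (B : set XC) -> exists M, forall x, B x -> p x <= M.
Proof.
move=> bB; apply: contrapT => /forallNP pB.
have /choice[x xP] n : exists x, B x /\ n.+1%:R ^+ 2 < p x.
  have /existsNP[x /not_implyP[Bx /negP]] := pB (n.+1%:R ^+ 2).
  by rewrite -ltNge; exists x.
pose y n := n.+1%:R^-1 *: x n.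
have [|V V0 Vy] := @localized_nbhs_avoid y p_lsc.
  move=> n; rewrite p_seminorm.2 normfV normr_nat ltr_pdivlMl//.
  apply: le_lt_trans (xP n).2; rewrite expr2 ler_wpM2l// ler_nat//.
have [r r0 rB] := bB _ V0.
pose n := Num.truncn r.
have rn : r <= `|n.+1%:R : R| by rewrite normr_nat ltW// truncnS_gt.
have [z Vz zx] := rB _ rn _ (xP n).1.
by apply: (Vy n); rewrite /y -zx scalerA mulVf// scale1r.
Qed.

Lemma localized_null_seq_bounded (u : nat -> XC) : u @ \oo --> (0 : XC) ->
  exists M, \forall n \near \oo, p (u n) <= M.
Proof.
move=> u0; apply: contrapT => /forallNP pu.
have /choice[m mP] n : exists m, (n <= m)%N /\ n%:R < p (u m).
  apply: contrapT => /forallNP H; apply: (pu n%:R); exists n => // m /= nm.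
  by rewrite leNgt; apply/negP => pm; apply: (H m).
have [|V V0 Vy] := @localized_nbhs_avoid (u \o m) p_lsc.
  by move=> n; have [] := mP n.
have [N _ NV] := u0 _ V0.
by apply: (Vy N); apply: NV; have [] := mP N.
Qed.

(** * Bornological, barrelled and Fréchet-Urysohn conditions *)

Lemma bornological_unit_ball_nbhs :
  bornological XC -> nbhs (0 : XC) [set x : XC | p x <= 1].
Proof.
have [cB bB] := seminorm_unit_ball p_seminorm.
move=> bornX; apply: bornX => // B /localized_bounded_seminorm[M BM].
exact: (seminorm_unit_ball_absorbs p_seminorm BM).
Qed.

Let closed_unit_ball : closed [set x : X | p x <= 1].
Proof.
rewrite (_ : mkset _ = ~` [set x | (1%:E < (p x)%:E)%E]).
  by apply: open_closedC; have /lower_semicontinuousP := p_lsc; apply.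
by apply/seteqP; split=> x /=; rewrite lte_fin leNgt => /negP.
Qed.

Lemma barrelled_unit_ball_nbhs :
  barrelled X -> nbhs (0 : X) [set x : X | p x <= 1].
Proof. exact: seminorm_unit_ball_barrelled. Qed.

Lemma localized_barrelled_unit_ball_nbhs :
  barrelled XC -> nbhs (0 : XC) [set x : XC | p x <= 1].
Proof.
apply: seminorm_unit_ball_barrelled => //; rewrite -openC.
by apply: open_localized; rewrite openC.
Qed.

(* If [p] were unbounded near [0], pick [a_j --> 0] with [a_j != 0] and disjoint
   neighbourhoods [P_j] of [a_j] and [Q_j] of [0]. Then [0] is in the closure of
   the set of all [w] in some [P_j] with [p (w - a_j) > j]. A null sequence in
   this set is bounded for [p], so it lies in finitely many of the [P_j],
   whereas it eventually avoids each of them. *)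
Lemma frechet_urysohn_unit_ball_nbhs : hausdorff_space X ->
  frechet_urysohn XC -> nbhs (0 : XC) [set x : XC | p x <= 1].
Proof.
move=> hX fuX; apply: contrapT => nB.
have big (N : set XC) : nbhs (0 : XC) N -> exists2 z, N z & 1 < p z.
  move=> nN; apply: contrapT => H; apply: nB.
  apply: filterS nN => z Nz /=; rewrite leNgt; apply/negP => pz.
  by apply: H; exists z.
have [a _ pa] := big setT filterT.
have a0 : a != 0.
  by apply: contraTneq pa => ->; rewrite (seminorm0 p_seminorm) ltr10.
pose s (j : nat) : X := j.+1%:R^-1 *: (a : X).
have ps j : p (s j) <= p a.
  rewrite p_seminorm.2 normfV normr_nat ler_piMl ?seminorm_ge0//.
  by rewrite invf_le1// ler1n.
have /choice[PQ PQP] j : exists PQ : set X * set X,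
    [/\ open PQ.1, PQ.1 (s j), nbhs (0 : X) PQ.2 & PQ.1 `&` PQ.2 = set0].
  have sj0 : s j != 0 by rewrite scaler_eq0 negb_or invr_eq0 pnatr_eq0.
  move: hX; rewrite open_hausdorff => /(_ _ _ sj0)[[P Q] /= [/set_mem Ps]].
  move=> /set_mem Q0 [oP oQ /eqP PQ]; exists (P, Q); split => //=.
  exact: open_nbhs_nbhs.
pose A := [set w : XC | exists j, (PQ j).1 w /\ j%:R < p (w - s j)].
(* The [s j] tend to 0 within one sublevel set, so some [s j] lies in [E]. Since [p] exceeds one in
   every neighbourhood of 0, [s j] can be moved by [(j+1) z] with [p z > 1] without leaving [E] and
   [(PQ j).1]. *)
have clA : closure A (0 : XC).
  move=> N; rewrite nbhsE => -[E [oE E0] EN].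
  pose k := (Num.truncn (p a)).+1.
  have pak : p a <= k%:R by rewrite ltW// truncnS_gt.
  have nE : nbhs (0 : XC) E by apply: open_nbhs_nbhs.
  have [|W nW WE] := localized_nbhs_trace nE (sublevel k).
    by rewrite /= (seminorm0 p_seminorm).
  have /nbhs_ballP[e /= e0 We] := scale_near0 (a : X) nW.
  have [j _ /(_ j (leqnn j))/= je] := near_infty_natSinv_lt (PosNum e0).
  have Esj : E (s j).
    apply: WE; split; last by rewrite /= (le_trans (ps j)).
    apply: We; rewrite /ball/= sub0r normrN normfV normr_nat.
    exact: je.
  have [oP Ps _ _] := PQP j.
  have := @localized_affine_continuous _ _ _ (s j : XC) j.+1%:R
    (sublevel_family_localizing p_seminorm).
  move=> /(_ 0 (E `&` (PQ j).1)); rewrite scaler0 addr0.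
  have nEP : nbhs (s j : XC) (E `&` (PQ j).1).
    apply: open_nbhs_nbhs; split => //; apply: openI => //.
    exact: open_localized.
  move=> /(_ nEP)/big[z /= [Ez Pz] pz]; exists (s j + j.+1%:R *: z); split.
    exists j; split => //.
    rewrite addrAC subrr add0r p_seminorm.2 normr_nat.
    by rewrite (@lt_trans _ _ j.+1%:R) ?ltr_nat// ltr_pMr.
  exact: EN.
have [u [Au u0]] := fuX A 0 clA.
have [M pM] := localized_null_seq_bounded u0.
pose J := (Num.truncn (M + p a)).+1.
have nQ : \forall n \near \oo, forall j : 'I_J, (PQ j).2 (u n).
  apply: filter_forall => j; have [_ _ Q0 _] := PQP j.
  by apply: u0; exact: nbhs_localized.
have [n [pn Qn]] := filter_ex (filterI pM nQ).
have [j [Pj jp]] := Au n.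
have jJ : (j < J)%N.
  rewrite -(ltr_nat R) (lt_le_trans jp)// (@le_trans _ _ (M + p a))//.
    by rewrite (le_trans (p_seminorm.1 _ _))// seminormN// lerD.
  by rewrite ltW// truncnS_gt.
have [_ _ _ PQ0] := PQP j.
suff : ((PQ j).1 `&` (PQ j).2) (u n) by rewrite PQ0.
by split => //; exact: (Qn (Ordinal jJ)).
Qed.

(** * Consequences of continuity of the seminorm *)

Lemma continuous_nbhs_seq (x : X) : continuous (p : X -> R) ->
  (forall k : nat, first_countable (set_type [set y : X | p y <= k%:R])) ->
  exists U : nat -> set X, [/\ forall n, nbhs x (U n),
    forall m n, (m <= n)%N -> U n `<=` U m &
    forall W, nbhs x W -> exists n, U n `<=` W].
Proof.
move=> cp fc; pose k := (Num.truncn (p x)).+1.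
have pxk : p x < k%:R by rewrite truncnS_gt.
have [|U [nU dU bU]] := @first_countable_nbhs_seq _ _ x (fc k).
  by rewrite /= ltW.
(* By continuity the sublevel set is a neighbourhood of [x], so the base of traces becomes a base at
   [x]. *)
exists (fun n => U n `&` [set y | p y <= k%:R]); split => //.
  by move=> n; apply: filterI => //; exact: (cvgr_le _ (cp x)).
by move=> m n mn; apply: setSI; exact: dU.
Qed.

Lemma continuous_localization_barrelled : continuous (p : X -> R) ->
  barrelled X <-> barrelled XC.
Proof.
move=> cp; have oE := continuous_localizationE cp.
have cE (A : set X) : closed A = @closed XC A.
  by rewrite -openC -[in RHS]openC [in LHS]oE.
split=> barX A cA bA clA aA.
- rewrite -(continuous_localization_nbhs _ _ cp); apply: barX => //.
  by rewrite cE.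
- rewrite (continuous_localization_nbhs _ _ cp); apply: barX => //.
  by rewrite -cE.
Qed.

Lemma continuous_localization_bornological : continuous (p : X -> R) ->
  bornological X -> bornological XC.
Proof.
move=> cp bornX A cA bA absA.
rewrite -(continuous_localization_nbhs _ _ cp); apply: bornX => // B bB.
apply: absA => U; rewrite -(continuous_localization_nbhs _ _ cp); exact: bB.
Qed.

End localization_seminorm.

(** * The implications, routed through continuity of [p] *)

Theorem theorem3p8 (R : realType) (X : tvsType R) (p : X -> R)
  (X_hausdorff : hausdorff_space X)
  (p_seminorm : seminorm p)
  (p_lsc : lower_semicontinuous (fun x => (p x)%:E))
  (fc : forall k : nat, first_countable (set_type [set x : X | p x <= k%:R])) :
  let XC := localization (sublevel_family p) in
  let P1 := barrelled X in
  let P2 := barrelled XC in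
  let P3 := continuous (p : X -> R) in
  let P4 := sequentially_continuous (p : X -> R) in
  let P5 := sequentially_continuous (p : XC -> R) in
  let P6 := continuous (p : XC -> R) in
  let P7 := frechet_urysohn XC in
  let P8 := bornological XC in
  let P9 := (seq_topology X : set (set X)) = @open XC in
  let P10 := (@open X : set (set X)) = @open XC in
  (* (A) *)
  [/\ P4 <-> P5, P5 <-> P6, P6 <-> P7 & P7 <-> P8] /\
  (* (B) *)
  (P1 \/ P2 \/ P3 -> [/\ P4, P5, P6, P7 & P8]) /\
  (* (C) *)
  (P3 -> P10) /\
  (* (D) *)
  (sequential XC -> P4 \/ P5 \/ P6 \/ P7 \/ P8 -> P9) /\
  (* (E) *)
  (sequential X -> sequential XC ->
    [/\ [/\ P3 <-> P4, P4 <-> P5, P5 <-> P6, P6 <-> P7 & P7 <-> P8],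
        P1 <-> P2,
        P1 \/ P2 -> [/\ P3, P4, P5, P6 & P7 /\ P8] &
        P3 \/ P4 \/ P5 \/ P6 \/ P7 \/ P8 -> P10]).
Proof.
move=> XC P1 P2 P3 P4 P5 P6 P7 P8 P9 P10.
have nbhs3 : nbhs (0 : X) [set x : X | p x <= 1] -> P3.
  exact: unit_ball_nbhs_continuous.
have XCnbhs3 : nbhs (0 : XC) [set x : XC | p x <= 1] -> P3.
  by move=> /(localized_unit_ball_nbhs p_seminorm)/nbhs3.
have e13 : P1 -> P3 by move=> /barrelled_unit_ball_nbhs/nbhs3; apply.
have e23 : P2 -> P3.
  by move=> /localized_barrelled_unit_ball_nbhs/XCnbhs3; apply.
have e310 : P3 -> P10 by exact: continuous_localizationE.
have e34 : P3 -> P4 by exact: continuous_sequentially.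
have e45 : P4 -> P5.
  move=> p4 u x ux; apply: p4 => W nW; apply: ux; exact: nbhs_localized.
have e53 : P5 -> P3.
  by move=> /(sequentially_localized_unit_ball_nbhs p_seminorm (fc 1))/nbhs3.
have e36 : P3 -> P6.
  by move=> p3 x W nW; apply: nbhs_localized; exact: p3.
have e65 : P6 -> P5 by exact: continuous_sequentially.
have e37 : P3 -> P7.
  move=> p3; apply: frechet_urysohn_nbhs_seq => x.
  have [U [nU dU bU]] := continuous_nbhs_seq x p3 fc.
  exists U; split => // [n|W]; first exact: nbhs_localized.
  by rewrite -(continuous_localization_nbhs _ _ p3); exact: bU.
have e73 : P7 -> P3.
  move=> fu; apply: XCnbhs3.
  exact: frechet_urysohn_unit_ball_nbhs p_seminorm p_lsc X_hausdorff fu.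
have e38 : P3 -> P8.
  move=> p3; have [U [nU dU bU]] := continuous_nbhs_seq 0 p3 fc.
  apply: continuous_localization_bornological => //.
  exact: bornological_nbhs_seq nU dU bU.
have e83 : P8 -> P3.
  by move=> /(bornological_unit_ball_nbhs p_seminorm p_lsc)/XCnbhs3.
have e312 : P3 -> (P1 <-> P2) by exact: continuous_localization_barrelled.
have all3 : P3 -> [/\ P4, P5, P6, P7 & P8].
  by move=> p3; split; tauto.
have any3 : P4 \/ P5 \/ P6 \/ P7 \/ P8 -> P3 by tauto.
split; first by split; tauto.
split; first by move=> H; apply: all3; tauto.
split; first exact: e310.
split.
  move=> seqXC /any3 p3; have oE := e310 p3.
  apply/seteqP; split => A oA.
    apply: seqXC => u x Ax ux; apply: (oA u x Ax) => W nW.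
    by apply: ux; exact: nbhs_localized.
  move=> u x Ax ux; apply: ux; apply: open_nbhs_nbhs; split => //.
  by rewrite oE.
move=> _ _; split; [by split; tauto|by tauto| |by move=> H; apply: e310; tauto].
by move=> H; split; tauto.
Qed.
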